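(* Let $Q\not\equiv 0$ and $R\not\equiv 0$ be rational functions, let $\alpha$ be a polynomial, and let $k\geq 1$ and $m\geq 2$ be integers. Then the differential equation $$f^m+\big(Rf^{(k)}\big)^m=Qe^{\alpha}$$ has no meromorphic solution $f$ on $\mathbb{C}$ of infinite order.
   Context: The order of a meromorphic function $f$ is $\rho(f)=\limsup_{r\to\infty}\frac{\log T(r,f)}{\log r}$, where $T(r,f)$ is the Nevanlinna characteristic function. *)

(* Defs.v *)
From HB Require Import structures.
From Stdlib Require Import Reals List.
From mathcomp Require Import Rstruct reals.
From mathcomp Require Import measure lebesgue_stieltjes_measure lebesgue_measure lebesgue_integral.
From mathcomp Require constructive_ereal.
From Coquelicot Require Import Coquelicot.
Open Scope R_scope.

Definition Cexp (z : C) : C := (exp (fst z) * cos (snd z), exp (fst z) * sin (snd z)).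

Definition peval (p : list C) (z : C) : C :=
  fold_right (fun a acc => Cplus a (Cmult z acc)) (RtoC 0) p.

Definition Cderiv (f : C -> C) (z l : C) : Prop :=
  is_derive (K := C_AbsRing) (V := C_NormedModule) f z l.

Definition Cdifferentiable (f : C -> C) (z : C) : Prop := exists l, Cderiv f z l.

Definition pole_of_order (f : C -> C) (p : C) (k : nat) : Prop :=
  (1 <= k)%nat /\
  exists (r : R) (g : C -> C),
    0 < r /\
    (forall w, Cmod (Cminus w p) < r -> Cdifferentiable g w) /\
    g p <> RtoC 0 /\
    (forall w, 0 < Cmod (Cminus w p) < r ->
               f w = Cdiv (g w) (Cpow (Cminus w p) k)).

(* f is meromorphic on C with pole set P: P has no accumulation point in C,
   f is holomorphic off P, and every point of P is a genuine pole.
   (Values of f on P are irrelevant.) *)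
Definition meromorphic (f : C -> C) (P : C -> Prop) : Prop :=
  (forall z, exists r, 0 < r /\ forall w, P w -> w <> z -> r <= Cmod (Cminus w z)) /\
  (forall z, ~ P z -> Cdifferentiable f z) /\
  (forall p, P p -> exists k, pole_of_order f p k).

Definition derivs_upto (k : nat) (P : C -> Prop) (f : C -> C) (fd : nat -> C -> C) : Prop :=
  fd O = f /\
  forall n z, (n < k)%nat -> ~ P z -> Cderiv (fd n) z (fd (S n) z).

Definition logplus (x : R) : R := Rmax 0 (ln x).

Definition Lint (g : R -> R) (a b : R) : R :=
  constructive_ereal.fine
    (lebesgue_integral_definition.integral
       (@lebesgue_measure.lebesgue_measure (R : realType))
       (fun x : R => a <= x <= b) (fun x : R => constructive_ereal.EFin (g x))).

Definition prox (f : C -> C) (r : R) : R :=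
  / (2 * PI) * Lint (fun t => logplus (Cmod (f (r * cos t, r * sin t)))) 0 (2 * PI).

Definition count_rel (f : C -> C) (P : C -> Prop) (t : R) (n : nat) : Prop :=
  exists l : list (C * nat),
    NoDup (map fst l) /\
    (forall p, (P p /\ Cmod p <= t) <-> In p (map fst l)) /\
    (forall pk, In pk l -> pole_of_order f (fst pk) (snd pk)) /\
    n = list_sum (map snd l).

(* n(t,f) (the unique such number) *)
Definition npoles (f : C -> C) (P : C -> Prop) (t : R) : R :=
  real (Lub_Rbar (fun x => exists n, count_rel f P t n /\ x = INR n)).

Definition Ncount (f : C -> C) (P : C -> Prop) (r : R) : R :=
  RInt (fun t => (npoles f P t - npoles f P 0) / t) 0 r + npoles f P 0 * ln r.

Definition Tchar (f : C -> C) (P : C -> Prop) (r : R) : R :=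
  prox f r + Ncount f P r.

Definition order (f : C -> C) (P : C -> Prop) : Rbar :=
  Rbar_glb (fun y => exists r0, 1 < r0 /\
     y = Lub_Rbar (fun x => exists r, r0 < r /\ x = ln (Tchar f P r) / ln r)).

(* Main.v *)
Require Import Defs.
From HB Require Import structures.
From Stdlib Require Import Reals List Lra Lia.
From Stdlib Require Import Classical FunctionalExtensionality PropExtensionality.
From mathcomp Require all_boot order ssralg ssrnum interval classical_sets functions
  ereal measure lebesgue_stieltjes_measure lebesgue_measure lebesgue_integral
  constructive_ereal.
From mathcomp Require Import Rstruct reals.
From Coquelicot Require Import Coquelicot.
Open Scope R_scope.

(* The equation gives [|R f^(k)| <= |f| + |Q e^alpha| + 1], so for large [|z|]
   the [k]-th derivative satisfies [|f^(k)| <= X |f| + X (X e^X + 1)] with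
   [X = B |z|^N].  Gronwall's inequality for [sum_(i<k) |f^(i)|^2] along a segment
   ending near a pole would bound [f] there, so all poles lie in a disc and
   [N(r,f) = O(log r)]; along rays it gives [log |f(z)| <= C |z|^(2N+1)], which
   bounds [m(r,f)].  Hence [T(r,f)] grows at most polynomially. *)

(** * Gronwall's inequality along segments *)

(** Both terms on the left carry the same exponent [m], so up to a source term [f^(k)] is bounded
    linearly by [f]; this linearity is what Gronwall's inequality requires. The zeros and poles of
    the coefficients are avoided by working outside a large disc, where rational functions have
    two-sided polynomial control; the initial data then come from compactness of a circle.
    Coefficients are bounded through a radius [rho >= |z|] rather than [|z|] itself, hence are
    constant along each segment, and Gronwall's inequality with constant coefficients suffices both
    near a pole and along a ray. The exponent [2N+1] is the rate [X^2], of size [|z|^(2N)], times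
    the length of the ray. *)

Lemma Cderiv_eps (f : C -> C) (z l : C) (eps : R) :
  Cderiv f z l -> 0 < eps ->
  exists d, 0 < d /\ forall w, Cmod (Cminus w z) < d ->
    Cmod (Cminus (Cminus (f w) (f z)) (Cmult (Cminus w z) l))
      <= eps * Cmod (Cminus w z).
Proof.
intros [_ H] He.
specialize (H z (fun P HP => HP) (mkposreal eps He)).
destruct H as [d Hd].
exists d; split; [apply cond_pos|].
intros w Hw; exact (Hd w Hw).
Qed.

Lemma Cderiv_continuous (f : C -> C) (z l : C) :
  Cderiv f z l ->
  exists d, 0 < d /\ forall w, Cmod (Cminus w z) < d ->
    Cmod (Cminus (f w) (f z)) <= (Cmod l + 1) * Cmod (Cminus w z).
Proof.
intros H.
destruct (Cderiv_eps f z l 1 H Rlt_0_1) as [d [Hd Hw]].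
exists d; split; [exact Hd|].
intros w Hwd; specialize (Hw w Hwd).
replace (Cminus (f w) (f z)) with
  (Cplus (Cminus (Cminus (f w) (f z)) (Cmult (Cminus w z) l)) (Cmult (Cminus w z) l)) by ring.
eapply Rle_trans; [apply Cmod_triangle|].
rewrite (Cmod_mult _ l).
lra.
Qed.

Lemma fst_le_Cmod (z : C) : Rabs (fst z) <= Cmod z.
Proof. eapply Rle_trans; [apply Rmax_l | apply Rmax_Cmod]. Qed.

Lemma snd_le_Cmod (z : C) : Rabs (snd z) <= Cmod z.
Proof. eapply Rle_trans; [apply Rmax_r | apply Rmax_Cmod]. Qed.

Lemma Cmod_sqr (z : C) : Cmod z ^ 2 = fst z ^ 2 + snd z ^ 2.
Proof.
unfold Cmod; apply pow2_sqrt.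
apply Rplus_le_le_0_compat; apply pow2_ge_0.
Qed.

Definition line (z0 u : C) (s : R) : C := Cplus z0 (Cmult (RtoC s) u).

(** The functional [p] stands for [fst] or [snd]: only real linearity and [|p z| <= |z|] enter, so
    one argument serves both coordinates. *)
Lemma is_derive_line (p : C -> R) (f : C -> C) (z0 u l : C) (s : R) :
  (forall z, Rabs (p z) <= Cmod z) ->
  (forall z w, p (Cminus z w) = p z - p w) ->
  (forall a z, p (Cmult (RtoC a) z) = a * p z) ->
  Cderiv f (line z0 u s) l ->
  is_derive (fun s => p (f (line z0 u s))) s (p (Cmult u l)).
Proof.
intros Hp Hm Hs H.
apply is_derive_Reals.
intros eps He.
assert (Hu : 0 <= Cmod u) by apply Cmod_ge_0.
assert (Hee : 0 < eps / (2 * (Cmod u + 1))) by (apply Rdiv_lt_0_compat; lra).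
destruct (Cderiv_eps _ _ _ _ H Hee) as [d [Hd Hw]].
assert (Hdd : 0 < d / (Cmod u + 1)) by (apply Rdiv_lt_0_compat; lra).
exists (mkposreal _ Hdd); simpl.
intros h Hh Hhd.
assert (Hh0 : 0 < Rabs h) by (apply Rabs_pos_lt; exact Hh).
assert (E : Cminus (line z0 u (s + h)) (line z0 u s) = Cmult (RtoC h) u).
{ unfold line; rewrite RtoC_plus; ring. }
specialize (Hw (line z0 u (s + h))).
rewrite E, Cmod_mult, Cmod_R in Hw.
assert (Hlt : Rabs h * Cmod u < d).
{ apply (Rmult_lt_compat_r (Cmod u + 1)) in Hhd; [|lra].
  replace (d / (Cmod u + 1) * (Cmod u + 1)) with d in Hhd by (field; lra).
  nra. }
specialize (Hw Hlt).
assert (Hb := Rle_trans _ _ _ (Hp _) Hw).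
rewrite !Hm in Hb.
replace (Cmult (Cmult (RtoC h) u) l) with (Cmult (RtoC h) (Cmult u l)) in Hb by ring.
rewrite Hs in Hb.
replace ((p (f (line z0 u (s + h))) - p (f (line z0 u s))) / h - p (Cmult u l))
  with ((p (f (line z0 u (s + h))) - p (f (line z0 u s)) - h * p (Cmult u l)) / h)
  by (field; exact Hh).
unfold Rdiv at 1; rewrite Rabs_mult, Rabs_inv.
apply (Rmult_lt_reg_r (Rabs h)); [exact Hh0|].
rewrite Rmult_assoc, Rinv_l, Rmult_1_r by lra.
eapply Rle_lt_trans; [exact Hb|].
replace (eps / (2 * (Cmod u + 1)) * (Rabs h * Cmod u))
  with (eps * Rabs h * (Cmod u / (2 * (Cmod u + 1)))) by (field; lra).
assert (Cmod u / (2 * (Cmod u + 1)) < 1).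
{ apply (Rmult_lt_reg_r (2 * (Cmod u + 1))); [lra|].
  unfold Rdiv; rewrite Rmult_assoc, Rinv_l; lra. }
assert (0 < eps * Rabs h) by (apply Rmult_lt_0_compat; lra).
nra.
Qed.

(** Squared moduli keep the sum differentiable along a line even where some [fd i] vanishes. *)
Definition energy (fd : nat -> C -> C) (n : nat) (z : C) : R :=
  sum_f_R0 (fun i => Cmod (fd i z) ^ 2) n.

Lemma energy_ge_0 fd n z : 0 <= energy fd n z.
Proof. apply cond_pos_sum; intros; apply pow2_ge_0. Qed.

Lemma energy_ge_head fd n z : Cmod (fd O z) ^ 2 <= energy fd n z.
Proof.
unfold energy; induction n as [|n IH]; cbn [sum_f_R0]; [lra|].
assert (H := pow2_ge_0 (Cmod (fd (S n) z))); lra.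
Qed.

Definition energy_slope (fd : nat -> C -> C) (n : nat) (u z : C) : R :=
  sum_f_R0 (fun i => 2 * (fst (fd i z) * fst (Cmult u (fd (S i) z))
                        + snd (fd i z) * snd (Cmult u (fd (S i) z)))) n.

Lemma is_derive_energy (fd : nat -> C -> C) (n : nat) (z0 u : C) (s : R) :
  (forall i, (i <= n)%nat -> Cderiv (fd i) (line z0 u s) (fd (S i) (line z0 u s))) ->
  is_derive (fun s => energy fd n (line z0 u s)) s (energy_slope fd n u (line z0 u s)).
Proof.
intros H.
assert (T : forall i, (i <= n)%nat ->
  is_derive (fun s => Cmod (fd i (line z0 u s)) ^ 2) s
   (2 * (fst (fd i (line z0 u s)) * fst (Cmult u (fd (S i) (line z0 u s)))
       + snd (fd i (line z0 u s)) * snd (Cmult u (fd (S i) (line z0 u s)))))).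
{ intros i Hi; specialize (H i Hi).
  assert (H1 : is_derive (fun s => fst (fd i (line z0 u s))) s
                 (fst (Cmult u (fd (S i) (line z0 u s))))).
  { apply (is_derive_line fst); auto using fst_le_Cmod.
    intros a [x y]; simpl; ring. }
  assert (H2 : is_derive (fun s => snd (fd i (line z0 u s))) s
                 (snd (Cmult u (fd (S i) (line z0 u s))))).
  { apply (is_derive_line snd); auto using snd_le_Cmod.
    intros a [x y]; simpl; ring. }
  apply (is_derive_ext (fun s => fst (fd i (line z0 u s)) ^ 2 + snd (fd i (line z0 u s)) ^ 2)).
  { intros t; symmetry; apply Cmod_sqr. }
  replace (2 * _) with
    (INR 2 * fst (Cmult u (fd (S i) (line z0 u s))) * fst (fd i (line z0 u s)) ^ pred 2
   + INR 2 * snd (Cmult u (fd (S i) (line z0 u s))) * snd (fd i (line z0 u s)) ^ pred 2)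
    by (simpl; ring).
  apply (is_derive_plus (V := R_NormedModule)); apply is_derive_pow; assumption. }
clear H; unfold energy, energy_slope; induction n as [|n IH]; cbn [sum_f_R0].
- apply T; lia.
- apply (is_derive_plus (V := R_NormedModule)).
  + apply IH; intros; apply T; lia.
  + apply T; lia.
Qed.

(** By [2ab <= a^2 + b^2], the [i]-th term costs the squares of index [i] and [i+1]. Summation
    counts each index at most twice, and [n+1] once. *)
Lemma energy_slope_le (fd : nat -> C -> C) (n : nat) (u z : C) :
  Cmod u = 1 ->
  energy_slope fd n u z <= 2 * energy fd n z + Cmod (fd (S n) z) ^ 2.
Proof.
intros Hu.
assert (T : forall i, 2 * (fst (fd i z) * fst (Cmult u (fd (S i) z))
                        + snd (fd i z) * snd (Cmult u (fd (S i) z)))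
                    <= Cmod (fd i z) ^ 2 + Cmod (fd (S i) z) ^ 2).
{ intros i.
  replace (Cmod (fd (S i) z) ^ 2) with (Cmod (Cmult u (fd (S i) z)) ^ 2)
    by (rewrite Cmod_mult, Hu; ring).
  rewrite !Cmod_sqr.
  generalize (Cmult u (fd (S i) z)); intros v.
  assert (H1 := pow2_ge_0 (fst (fd i z) - fst v)).
  assert (H2 := pow2_ge_0 (snd (fd i z) - snd v)).
  lra. }
assert (H : energy_slope fd n u z
   <= 2 * energy fd n z + Cmod (fd (S n) z) ^ 2 - Cmod (fd O z) ^ 2).
{ unfold energy_slope, energy; induction n as [|n IH]; cbn [sum_f_R0].
  - specialize (T O); lra.
  - specialize (T (S n)); lra. }
assert (H0 := pow2_ge_0 (Cmod (fd O z))); lra.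
Qed.

(** The function [(E + N) exp(-L s)] has nonpositive derivative, so the mean value theorem compares
    its values at [0] and [b]. *)
Lemma exp_weighted_decreasing (E dE : R -> R) (L N b : R) :
  0 <= b ->
  (forall s, 0 <= s <= b -> is_derive E s (dE s)) ->
  (forall s, 0 <= s <= b -> dE s <= L * (E s + N)) ->
  E b + N <= (E 0 + N) * exp (L * b).
Proof.
intros Hb Hd Hle.
set (G := fun s => (E s + N) * exp (- L * s)).
set (dG := fun s => (dE s - L * (E s + N)) * exp (- L * s)).
assert (HG : forall s, 0 <= s <= b -> is_derive G s (dG s)).
{ intros s Hs; unfold G, dG.
  assert (He := Hd s Hs).
  assert (Hx : ex_derive E s) by (eexists; exact He).
  auto_derive; [exact Hx|].
  replace (Derive (fun x => E x) s) with (dE s) by (symmetry; apply is_derive_unique; exact He).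
  ring. }
destruct (MVT_gen G 0 b dG) as [c [Hc Heq]].
- intros x; rewrite Rmin_left, Rmax_right by lra; intros; apply HG; lra.
- intros x; rewrite Rmin_left, Rmax_right by lra; intros Hx.
  apply continuity_pt_filterlim, (ex_derive_continuous G); eexists; apply HG; lra.
- rewrite Rmin_left, Rmax_right in Hc by lra.
  assert (HdG : dG c <= 0).
  { unfold dG; assert (H := Hle c Hc); assert (H' := exp_pos (- L * c)); nra. }
  assert (HGb : G b <= G 0) by nra.
  unfold G in HGb; rewrite Rmult_0_r, exp_0, Rmult_1_r in HGb.
  apply (Rmult_le_compat_r (exp (L * b))) in HGb; [|left; apply exp_pos].
  rewrite Rmult_assoc, <- exp_plus in HGb.
  replace (- L * b + L * b) with 0 in HGb by ring.
  rewrite exp_0 in HGb; lra.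
Qed.

(** From [(K y + M)^2 <= 2 K^2 y^2 + 2 M^2] the slope is at most [(2 + 2 K^2) (energy + M^2)]:
    adding [M^2] to the energy absorbs the inhomogeneous term. *)
Lemma energy_gronwall (fd : nat -> C -> C) (n : nat) (z0 u : C) (K M b : R) :
  Cmod u = 1 -> 0 <= b -> 0 <= K -> 0 <= M ->
  (forall s i, 0 <= s <= b -> (i <= n)%nat ->
     Cderiv (fd i) (line z0 u s) (fd (S i) (line z0 u s))) ->
  (forall s, 0 <= s <= b ->
     Cmod (fd (S n) (line z0 u s)) <= K * Cmod (fd O (line z0 u s)) + M) ->
  Cmod (fd O (line z0 u b)) ^ 2
    <= (energy fd n z0 + M ^ 2) * exp ((2 + 2 * K ^ 2) * b).
Proof.
intros Hu Hb HK HM Hd Hle.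
assert (H := exp_weighted_decreasing (fun s => energy fd n (line z0 u s))
  (fun s => energy_slope fd n u (line z0 u s)) (2 + 2 * K ^ 2) (M ^ 2) b Hb).
assert (E0 : line z0 u 0 = z0) by (unfold line; ring).
cbv beta in H; rewrite E0 in H.
assert (H1 := energy_ge_head fd n (line z0 u b)).
assert (H2 := pow2_ge_0 M).
eapply Rle_trans; [|apply H].
- lra.
- intros s Hs; apply is_derive_energy; auto.
- intros s Hs; cbv beta.
  assert (S1 := energy_slope_le fd n u (line z0 u s) Hu).
  assert (S2 := energy_ge_head fd n (line z0 u s)).
  assert (S3 := Hle s Hs).
  assert (S4 := Cmod_ge_0 (fd (S n) (line z0 u s))).
  assert (S5 := Cmod_ge_0 (fd O (line z0 u s))).
  set (y := Cmod (fd O (line z0 u s))) in *.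
  set (x := Cmod (fd (S n) (line z0 u s))) in *.
  assert (x ^ 2 <= (K * y + M) ^ 2) by (apply pow_incr; lra).
  assert ((K * y + M) ^ 2 <= 2 * K ^ 2 * y ^ 2 + 2 * M ^ 2).
  { assert (0 <= (K * y - M) ^ 2) by apply pow2_ge_0; nra. }
  assert (0 <= K ^ 2) by apply pow2_ge_0.
  assert (K ^ 2 * y ^ 2 <= K ^ 2 * energy fd n (line z0 u s)) by (apply Rmult_le_compat_l; lra).
  nra.
Qed.

(** * The differential inequality and the poles *)

Lemma peval_bounded_below (p : list C) :
  (exists z, peval p z <> RtoC 0) ->
  exists c r0, 0 < c /\ forall z, r0 <= Cmod z -> c <= Cmod (peval p z).
Proof.
intros Hp.
(* The induction needs a dichotomy, since the tail of a nonzero polynomial in Horner form may vanish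
   identically. *)
assert (D : (forall z, peval p z = RtoC 0) \/
  exists c r0, 0 < c /\ forall z, r0 <= Cmod z -> c <= Cmod (peval p z)).
{ clear Hp; induction p as [|a p [IH|[c [r0 [Hc IH]]]]]; simpl peval.
  - left; reflexivity.
  - destruct (Ceq_dec a (RtoC 0)) as [Ha|Ha].
    + left; intros z; rewrite Ha, IH; ring.
    + right; exists (Cmod a), 0; split; [apply Cmod_gt_0; exact Ha|].
      intros z _; rewrite IH; right; f_equal; ring.
  (* Beyond this radius [|z| |peval p z| >= 1 + |a|], which leaves [1] after subtracting the
     constant coefficient. *)
  - right; exists 1, (Rmax r0 ((1 + Cmod a) / c)); split; [lra|].
    intros z Hz.
    assert (H1 := Rle_trans _ _ _ (Rmax_l _ _) Hz).
    assert (H2 := Rle_trans _ _ _ (Rmax_r _ _) Hz).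
    specialize (IH z H1).
    apply (Rmult_le_compat_r c) in H2; [|lra].
    replace ((1 + Cmod a) / c * c) with (1 + Cmod a) in H2 by (field; lra).
    assert (H3 := Cmod_triangle (Cplus a (Cmult z (peval p z))) (Copp a)).
    replace (Cplus (Cplus a (Cmult z (peval p z))) (Copp a))
      with (Cmult z (peval p z)) in H3 by ring.
    rewrite Cmod_opp, Cmod_mult in H3.
    assert (Cmod z * c <= Cmod z * Cmod (peval p z))
      by (apply Rmult_le_compat_l; [apply Cmod_ge_0 | exact IH]).
    lra. }
destruct D as [D|D]; [|exact D].
destruct Hp as [z Hz]; contradict Hz; apply D.
Qed.

Lemma peval_bounded_above (p : list C) :
  exists B n, 1 <= B /\ forall z rho, 1 <= rho -> Cmod z <= rho ->
    Cmod (peval p z) <= B * rho ^ n.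
Proof.
induction p as [|a p [B [n [HB IH]]]]; simpl peval.
- exists 1, O; split; [lra|]; intros; rewrite Cmod_0; simpl; lra.
- assert (Ha := Cmod_ge_0 a).
  exists (Cmod a + B), (S n); split; [lra|].
  intros z rho Hr Hz.
  specialize (IH z rho Hr Hz).
  eapply Rle_trans; [apply Cmod_triangle|].
  rewrite Cmod_mult, Rmult_plus_distr_r.
  apply Rplus_le_compat.
  + assert (1 <= rho ^ S n) by (apply pow_R1_Rle; exact Hr); nra.
  + replace (B * rho ^ S n) with (rho * (B * rho ^ n)) by (simpl; ring).
    apply Rmult_le_compat; auto using Cmod_ge_0.
Qed.

Lemma monomial_le (B B' rho : R) (n n' : nat) :
  0 <= B <= B' -> 1 <= rho -> (n <= n')%nat -> B * rho ^ n <= B' * rho ^ n'.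
Proof.
intros HB Hr Hn.
apply Rmult_le_compat; [lra| | lra | apply Rle_pow; assumption].
apply pow_le; lra.
Qed.

Lemma pow_add_ge (y d : R) (m : nat) :
  (1 <= m)%nat -> 0 <= y -> 1 <= d -> y ^ m + d <= (y + d) ^ m.
Proof.
intros Hm Hy Hd; induction Hm as [|m Hm IH]; [simpl; lra|].
simpl pow.
assert (0 <= y ^ m) by (apply pow_le; exact Hy).
assert ((y + d) * (y ^ m + d) <= (y + d) * (y + d) ^ m)
  by (apply Rmult_le_compat_l; lra).
nra.
Qed.

(** This replaces taking [m]-th roots. The shift is [c + 1] because [pow_add_ge] asks for an
    increment of at least [1]; it gives [(y + c + 1)^m >= y^m + c + 1], more than [x^m] can
    reach. *)
Lemma le_of_pow_le (x y c : R) (m : nat) :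
  (1 <= m)%nat -> 0 <= y -> 0 <= c -> x ^ m <= y ^ m + c -> x <= y + (c + 1).
Proof.
intros Hm Hy Hc H.
destruct (Rle_or_lt x (y + (c + 1))) as [Hx|Hx]; [exact Hx|].
assert (H1 := pow_add_ge y (c + 1) m Hm Hy ltac:(lra)).
assert (H2 : (y + (c + 1)) ^ m <= x ^ m) by (apply pow_incr; lra).
lra.
Qed.

Lemma Cmod_Cexp (w : C) : Cmod (Cexp w) = exp (fst w).
Proof.
assert (H : Cmod (Cexp w) ^ 2 = exp (fst w) ^ 2).
{ rewrite Cmod_sqr; unfold Cexp; cbn [fst snd].
  assert (H := sin2_cos2 (snd w)); unfold Rsqr in H.
  transitivity (exp (fst w) ^ 2 * (sin (snd w) * sin (snd w) + cos (snd w) * cos (snd w)));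
    [ring | rewrite H; ring]. }
apply Rsqr_inj; [apply Cmod_ge_0 | left; apply exp_pos | unfold Rsqr; lra].
Qed.

Lemma Cmod_Cpow (z : C) (m : nat) : Cmod (Cpow z m) = Cmod z ^ m.
Proof.
induction m as [|m IH]; simpl; [apply Cmod_1|].
rewrite Cmod_mult, IH; reflexivity.
Qed.

(** Here [X * exp X] bounds [|Q e^alpha|], the [1] comes from [le_of_pow_le], and the outer [X]
    bounds [1/|R|]. *)
Definition source_bound (X : R) : R := X * (X * exp X + 1).

(* Since [|R f^(k)|^m <= |f|^m + |Q e^alpha|], the equation controls the top
   derivative linearly by [f]. *)
Lemma equation_differential_inequality (q1 q2 r1 r2 alpha : list C) (m : nat)
  (f g : C -> C) (D : C -> Prop) :
  (exists z, peval q2 z <> RtoC 0) ->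
  (exists z, peval r1 z <> RtoC 0) -> (exists z, peval r2 z <> RtoC 0) ->
  (1 <= m)%nat ->
  (forall z, D z -> peval q2 z <> RtoC 0 -> peval r2 z <> RtoC 0 ->
     Cplus (Cpow (f z) m)
           (Cpow (Cmult (Cdiv (peval r1 z) (peval r2 z)) (g z)) m)
     = Cmult (Cdiv (peval q1 z) (peval q2 z)) (Cexp (peval alpha z))) ->
  exists B n r0, 1 <= B /\ 1 <= r0 /\
    forall z rho, D z -> r0 <= Cmod z -> Cmod z <= rho ->
      Cmod (g z) <= B * rho ^ n * Cmod (f z) + source_bound (B * rho ^ n).
Proof.
intros Hq2 Hr1 Hr2 Hm Heq.
destruct (peval_bounded_below _ Hq2) as [c2 [s2 [Hc2 Lq2]]].
destruct (peval_bounded_below _ Hr1) as [c1 [s1 [Hc1 Lr1]]].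
destruct (peval_bounded_below _ Hr2) as [c3 [s3 [Hc3 Lr2]]].
destruct (peval_bounded_above q1) as [B1 [n1 [HB1 Uq1]]].
destruct (peval_bounded_above r2) as [B2 [n2 [HB2 Ur2]]].
destruct (peval_bounded_above alpha) as [B3 [n3 [HB3 Ua]]].
assert (P1 : 0 < B1 / c2) by (apply Rdiv_lt_0_compat; lra).
assert (P2 : 0 < B2 / c1) by (apply Rdiv_lt_0_compat; lra).
(* A single monomial dominates the bounds for [|Q|], [1/|R|] and [|alpha|]. *)
exists (B1 / c2 + B2 / c1 + B3), (n1 + n2 + n3)%nat, (Rmax 1 (Rmax s1 (Rmax s2 s3))).
split; [lra|]; split; [apply Rmax_l|].
intros z rho HD Hz Hrho.
assert (Z1 := Rle_trans _ _ _ (Rmax_l _ _) Hz).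
assert (Z := Rle_trans _ _ _ (Rmax_r _ _) Hz).
assert (Zs1 := Rle_trans _ _ _ (Rmax_l _ _) Z).
assert (Z' := Rle_trans _ _ _ (Rmax_r _ _) Z).
assert (Zs2 := Rle_trans _ _ _ (Rmax_l _ _) Z').
assert (Zs3 := Rle_trans _ _ _ (Rmax_r _ _) Z').
specialize (Lq2 z Zs2); specialize (Lr1 z Zs1); specialize (Lr2 z Zs3).
assert (Hr : 1 <= rho) by lra.
specialize (Uq1 z rho Hr Hrho); specialize (Ur2 z rho Hr Hrho); specialize (Ua z rho Hr Hrho).
assert (N1 : peval r1 z <> RtoC 0) by (apply Cmod_gt_0; lra).
assert (N2 : peval r2 z <> RtoC 0) by (apply Cmod_gt_0; lra).
assert (N3 : peval q2 z <> RtoC 0) by (apply Cmod_gt_0; lra).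
specialize (Heq z HD N3 N2).
set (X := (B1 / c2 + B2 / c1 + B3) * rho ^ (n1 + n2 + n3)).
assert (X1 : B1 / c2 * rho ^ n1 <= X) by (apply monomial_le; [lra | lra | lia]).
assert (X2 : B2 / c1 * rho ^ n2 <= X) by (apply monomial_le; [lra | lra | lia]).
assert (X3 : B3 * rho ^ n3 <= X) by (apply monomial_le; [lra | lra | lia]).
assert (PX : 0 <= X).
{ eapply Rle_trans; [|exact X3]; apply Rmult_le_pos; [lra|apply pow_le; lra]. }
set (v := Cmult (Cdiv (peval r1 z) (peval r2 z)) (g z)) in *.
assert (Hgv : g z = Cmult (Cdiv (peval r2 z) (peval r1 z)) v).
{ unfold v; field; split; assumption. }
assert (Hq : Cmod (Cdiv (peval q1 z) (peval q2 z)) <= X).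
{ rewrite Cmod_div by exact N3.
  eapply Rle_trans; [|exact X1].
  replace (B1 / c2 * rho ^ n1) with ((B1 * rho ^ n1) * / c2) by (field; lra).
  apply Rmult_le_compat; [apply Cmod_ge_0 | left; apply Rinv_0_lt_compat; lra | exact Uq1
   | apply Rinv_le_contravar; lra]. }
assert (Hrr : Cmod (Cdiv (peval r2 z) (peval r1 z)) <= X).
{ rewrite Cmod_div by exact N1.
  eapply Rle_trans; [|exact X2].
  replace (B2 / c1 * rho ^ n2) with ((B2 * rho ^ n2) * / c1) by (field; lra).
  apply Rmult_le_compat; [apply Cmod_ge_0 | left; apply Rinv_0_lt_compat; lra | exact Ur2
   | apply Rinv_le_contravar; lra]. }
assert (He : Cmod (Cexp (peval alpha z)) <= exp X).
{ rewrite Cmod_Cexp.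
  assert (fst (peval alpha z) <= X).
  { eapply Rle_trans; [apply Rle_abs|].
    eapply Rle_trans; [apply fst_le_Cmod|]; lra. }
  destruct H as [H|H]; [left; apply exp_increasing; exact H | rewrite H; lra]. }
assert (Hv : Cmod v ^ m <= Cmod (f z) ^ m + X * exp X).
{ rewrite <- !Cmod_Cpow.
  replace (Cpow v m) with
    (Cplus (Copp (Cpow (f z) m)) (Cplus (Cpow (f z) m) (Cpow v m))) by ring.
  rewrite Heq.
  eapply Rle_trans; [apply Cmod_triangle|].
  rewrite Cmod_opp, Cmod_mult.
  apply Rplus_le_compat_l, Rmult_le_compat; auto using Cmod_ge_0. }
assert (PXe : 0 <= X * exp X) by (apply Rmult_le_pos; [exact PX | left; apply exp_pos]).
apply le_of_pow_le in Hv; [|exact Hm | apply Cmod_ge_0 | exact PXe].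
rewrite Hgv, Cmod_mult; unfold source_bound.
rewrite <- Rmult_plus_distr_l.
apply Rmult_le_compat; auto using Cmod_ge_0.
Qed.

(* Integrating the differential inequality towards the pole bounds [f] there. *)
Lemma pole_excludes_differential_inequality (f : C -> C) (fd : nat -> C -> C)
  (n j : nat) (p : C) (d K M : R) :
  pole_of_order f p j -> fd O = f -> 0 < d -> 0 <= K -> 0 <= M ->
  (forall w, 0 < Cmod (Cminus w p) < d ->
     (forall i, (i <= n)%nat -> Cderiv (fd i) w (fd (S i) w)) /\
     Cmod (fd (S n) w) <= K * Cmod (f w) + M) ->
  False.
Proof.
intros [Hj [r [g [Hr [Hg [Hgp Hfg]]]]]] Hf0 Hd HK HM Hode.
destruct (Hg p) as [l Hl].
{ replace (Cminus p p) with (RtoC 0) by ring; rewrite Cmod_0; exact Hr. }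
destruct (Cderiv_continuous g p l Hl) as [d1 [Hd1 Hcont]].
apply Cmod_gt_0 in Hgp.
assert (Pl : 0 <= Cmod l) by apply Cmod_ge_0.
set (c := Cmod (g p) / 2).
assert (Hc : 0 < c) by (unfold c; lra).
assert (Pq : 0 < c / (Cmod l + 1)) by (apply Rdiv_lt_0_compat; lra).
(* Starting distance from [p]: below [1] so that [t ^ j <= t], below [c / (Cmod l + 1)] so that
   [|g| >= c], and within the discs where the differential inequality, the quotient formula for [f]
   and the estimate of [g] hold. *)
set (e := Rmin (Rmin 1 (c / (Cmod l + 1))) (Rmin d (Rmin r d1)) / 2).
assert (He : 0 < e).
{ unfold e; apply Rdiv_lt_0_compat; [|lra].
  repeat apply Rmin_glb_lt; lra. }
assert (Hmin : e < Rmin (Rmin 1 (c / (Cmod l + 1))) (Rmin d (Rmin r d1))).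
{ unfold e in *; lra. }
assert (E1 := Rlt_le_trans _ _ _ Hmin (Rmin_l _ _)).
assert (E2 := Rlt_le_trans _ _ _ Hmin (Rmin_r _ _)).
assert (e_lt_1 := Rlt_le_trans _ _ _ E1 (Rmin_l _ _)).
assert (e_lt_c := Rlt_le_trans _ _ _ E1 (Rmin_r _ _)).
assert (e_lt_d := Rlt_le_trans _ _ _ E2 (Rmin_l _ _)).
assert (E3 := Rlt_le_trans _ _ _ E2 (Rmin_r _ _)).
assert (e_lt_r := Rlt_le_trans _ _ _ E3 (Rmin_l _ _)).
assert (e_lt_d1 := Rlt_le_trans _ _ _ E3 (Rmin_r _ _)).
clearbody e; clear Hmin E1 E2 E3.
(* The segment runs horizontally towards [p]; at parameter [s] its distance from [p] is [e - s]. *)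
set (z0 := Cplus p (RtoC e)).
set (u := RtoC (-1)).
assert (Hline : forall s, Cminus (line z0 u s) p = RtoC (e - s)).
{ intros s; unfold line, z0, u; rewrite <- RtoC_mult.
  replace (RtoC (e - s)) with (Cplus (RtoC e) (RtoC (s * -1)))
    by (rewrite <- RtoC_plus; f_equal; ring).
  ring. }
assert (Hmod : forall s, s < e -> Cmod (Cminus (line z0 u s) p) = e - s).
{ intros s Hs; rewrite Hline, Cmod_R; apply Rabs_pos_eq; lra. }
set (A := (energy fd n z0 + M ^ 2) * exp ((2 + 2 * K ^ 2) * e)).
assert (PE := energy_ge_0 fd n z0).
assert (PM := pow2_ge_0 M).
assert (PK := pow2_ge_0 K).
assert (HA : 0 <= A) by (apply Rmult_le_pos; [lra | left; apply exp_pos]).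
assert (Hup : forall s, 0 <= s < e -> Cmod (f (line z0 u s)) ^ 2 <= A).
{ intros s Hs; rewrite <- Hf0.
  eapply Rle_trans.
  - apply (energy_gronwall fd n z0 u K M s).
    + unfold u; rewrite Cmod_R, Rabs_left; lra.
    + lra.
    + exact HK.
    + exact HM.
    + intros t i Ht Hi; apply Hode; [rewrite Hmod; lra | exact Hi].
    + intros t Ht; rewrite Hf0; apply Hode; rewrite Hmod; lra.
  - apply Rmult_le_compat_l; [lra|].
    assert ((2 + 2 * K ^ 2) * s <= (2 + 2 * K ^ 2) * e) by (apply Rmult_le_compat_l; lra).
    destruct H as [H|H]; [left; apply exp_increasing; exact H | rewrite H; lra]. }
(* At distance [t] the pole forces [|f| >= c / t >= A + 1], whereas [|f|^2 <= A] by Gronwall's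
   inequality. *)
set (t := Rmin e (c / (A + 1))).
assert (Pc : 0 < c / (A + 1)) by (apply Rdiv_lt_0_compat; lra).
assert (Ht : 0 < t) by (apply Rmin_glb_lt; lra).
assert (Hte : t <= e) by apply Rmin_l.
assert (Htc : t <= c / (A + 1)) by apply Rmin_r.
clearbody t.
assert (Hs : 0 <= e - t < e) by lra.
specialize (Hup _ Hs).
assert (Hw := Hmod (e - t) ltac:(lra)).
replace (e - (e - t)) with t in Hw by ring.
set (w := line z0 u (e - t)) in *.
assert (Nw : Cminus w p <> RtoC 0) by (apply Cmod_gt_0; lra).
rewrite Hfg in Hup by lra.
rewrite Cmod_div in Hup by (apply Cpow_nz; exact Nw).
rewrite Cmod_Cpow, Hw in Hup.
assert (Hgw : c <= Cmod (g w)).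
{ specialize (Hcont w ltac:(lra)); rewrite Hw in Hcont.
  assert (H1 := Cmod_triangle (g w) (Copp (Cminus (g w) (g p)))).
  replace (Cplus (g w) (Copp (Cminus (g w) (g p)))) with (g p) in H1 by ring.
  rewrite Cmod_opp in H1.
  assert ((Cmod l + 1) * t <= (Cmod l + 1) * (c / (Cmod l + 1)))
    by (apply Rmult_le_compat_l; lra).
  replace ((Cmod l + 1) * (c / (Cmod l + 1))) with c in H by (field; lra).
  unfold c in *; lra. }
assert (Htj : 0 < t ^ j <= t).
{ split; [apply pow_lt; exact Ht|].
  replace t with (t ^ 1) at 2 by ring.
  destruct j as [|j]; [lia|].
  simpl; apply Rmult_le_compat_l; [lra|].
  rewrite <- (pow1 j); apply pow_incr; lra. }
assert (Hbig : A + 1 <= Cmod (g w) / t ^ j).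
{ apply (Rmult_le_reg_r (t ^ j)); [lra|].
  unfold Rdiv; rewrite Rmult_assoc, Rinv_l, Rmult_1_r by lra.
  apply (Rmult_le_compat_l (A + 1)) in Htc; [|lra].
  replace ((A + 1) * (c / (A + 1))) with c in Htc by (field; lra).
  assert ((A + 1) * t ^ j <= (A + 1) * t) by (apply Rmult_le_compat_l; lra).
  lra. }
assert ((A + 1) ^ 2 <= (Cmod (g w) / t ^ j) ^ 2) by (apply pow_incr; lra).
nra.
Qed.

(** * Growth along rays *)

Definition circle (r t : R) : C := (r * cos t, r * sin t).

Lemma Cmod_circle (r t : R) : 0 <= r -> Cmod (circle r t) = r.
Proof.
intros Hr.
apply Rsqr_inj; [apply Cmod_ge_0 | exact Hr|].
rewrite !Rsqr_pow2, Cmod_sqr; unfold circle; cbn [fst snd].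
assert (H := sin2_cos2 t); unfold Rsqr in H.
transitivity (r ^ 2 * (sin t * sin t + cos t * cos t)); [ring | rewrite H; ring].
Qed.

Lemma line_circle (r s t : R) : line (circle r t) (circle 1 t) s = circle (r + s) t.
Proof.
unfold line, circle, Cplus, Cmult, RtoC; simpl; f_equal; ring.
Qed.

Lemma continuous_along_circle (f : C -> C) (r t : R) (l : C) :
  Cderiv f (circle r t) l ->
  continuous (U := C_UniformSpace) (fun t : R => f (circle r t)) t.
Proof.
intros H.
apply (continuous_comp (V := C_UniformSpace) (W := C_UniformSpace) (circle r) f).
- apply (continuous_comp_2 (fun t => r * cos t) (fun t => r * sin t) (fun x y : R => (x, y) : C_UniformSpace)).
  + apply (continuous_scal_r r cos), continuous_cos.
  + apply (continuous_scal_r r sin), continuous_sin.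
  + intros Q [d HQ]; exists d; intros [x y] Hxy; exact (HQ (x, y) Hxy).
(* Differentiability gives continuity for the uniform structure of the modulus; [locally_C] carries
   it to the product structure. *)
- assert (H1 : continuous (T := AbsRing_UniformSpace C_AbsRing) (U := C_NormedModule) f (circle r t)).
  { apply (ex_derive_continuous (K := C_AbsRing) (V := C_NormedModule)); exists l; exact H. }
  intros Q HQ; specialize (H1 Q HQ).
  apply locally_C; exact H1.
Qed.

(** Compactness makes the initial energy of all rays leaving the circle uniformly bounded. *)
Lemma energy_bounded_on_circle (fd : nat -> C -> C) (n : nat) (r : R) :
  (forall i t, (i <= n)%nat -> exists l, Cderiv (fd i) (circle r t) l) ->
  exists E, forall t, 0 <= t <= 2 * PI -> energy fd n (circle r t) <= E.
Proof.
intros Hd.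
assert (Hc : forall t, continuous (fun t => energy fd n (circle r t)) t).
{ intros t.
  assert (Hi : forall i, (i <= n)%nat -> continuous (fun t => Cmod (fd i (circle r t)) ^ 2) t).
  { intros i Hi; destruct (Hd i t Hi) as [l Hl].
    apply continuous_along_circle in Hl.
    apply (continuous_ext (fun t => fst (fd i (circle r t)) * fst (fd i (circle r t))
      + snd (fd i (circle r t)) * snd (fd i (circle r t)))).
    { intros x; rewrite Cmod_sqr; simpl; ring. }
    assert (H1 : continuous (fun t => fst (fd i (circle r t))) t)
      by (apply (continuous_comp _ fst); [exact Hl | apply continuous_fst]).
    assert (H2 : continuous (fun t => snd (fd i (circle r t))) t)
      by (apply (continuous_comp _ snd); [exact Hl | apply continuous_snd]).
    apply (continuous_plus (V := R_NormedModule));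
      apply (continuous_mult (K := R_AbsRing)); assumption. }
  clear Hd; unfold energy; induction n as [|k IH]; cbn [sum_f_R0].
  - apply Hi; lia.
  - apply (continuous_plus (V := R_NormedModule)); [apply IH; intros|]; apply Hi; lia. }
destruct (continuity_ab_maj (fun t => energy fd n (circle r t)) 0 (2 * PI)) as [M [HM _]].
- assert (H := PI_RGT_0); lra.
- intros t _; apply continuity_pt_filterlim, Hc.
- exists (energy fd n (circle r M)); exact HM.
Qed.

Lemma exp_le (x y : R) : x <= y -> exp x <= exp y.
Proof. intros [H|H]; [left; apply exp_increasing; exact H | rewrite H; lra]. Qed.

(** With [X <= exp X] and [2 <= exp X], the source is at most [exp (4 * X)]. *)
Lemma source_bound_sqr_le (X : R) : 1 <= X -> source_bound X ^ 2 <= exp (8 * X).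
Proof.
intros HX; unfold source_bound.
assert (H1 : X <= exp X) by (assert (H := exp_ineq1_le X); lra).
assert (H2 : 2 <= exp X) by (assert (H := exp_ineq1_le X); lra).
assert (H3 : X * (X * exp X + 1) <= exp X * (exp X * (exp X * exp X))).
{ apply Rmult_le_compat; [lra | | exact H1 |].
  - apply Rplus_le_le_0_compat; [apply Rmult_le_pos|]; lra.
  - assert (X * exp X <= exp X * exp X) by (apply Rmult_le_compat_r; lra).
    assert (2 * (exp X * exp X) <= exp X * (exp X * exp X)) by (apply Rmult_le_compat_r; nra).
    nra. }
rewrite <- !exp_plus in H3.
apply Rle_trans with (exp (X + (X + (X + X))) ^ 2).
- apply pow_incr; split; [|exact H3].
  apply Rmult_le_pos; [lra|]; apply Rplus_le_le_0_compat; [apply Rmult_le_pos|]; lra.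
- simpl; rewrite Rmult_1_r, <- exp_plus; apply exp_le; lra.
Qed.

Lemma exp_growth_of_differential_inequality
  (fd : nat -> C -> C) (n N : nat) (B r1 : R) :
  1 <= B -> 1 <= r1 ->
  (forall z i, r1 <= Cmod z -> (i <= n)%nat -> Cderiv (fd i) z (fd (S i) z)) ->
  (forall z rho, r1 <= Cmod z -> Cmod z <= rho ->
     Cmod (fd (S n) z) <= B * rho ^ N * Cmod (fd O z) + source_bound (B * rho ^ N)) ->
  exists C0, 0 <= C0 /\ forall r t, r1 <= r -> 0 <= t <= 2 * PI ->
    Cmod (fd O (circle r t)) <= exp (C0 * r ^ (2 * N + 1)).
Proof.
intros HB Hr1 Hd Hle.
destruct (energy_bounded_on_circle fd n r1) as [E HE].
{ intros i t Hi; eexists; apply Hd; [rewrite Cmod_circle; lra | exact Hi]. }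
assert (PE : 0 <= E).
{ eapply Rle_trans; [apply (energy_ge_0 fd n (circle r1 0)) | apply HE].
  assert (H := PI_RGT_0); lra. }
exists (E + 8 * B + (2 + 2 * B ^ 2)).
assert (PB : 0 <= B ^ 2) by apply pow2_ge_0.
split; [lra|].
intros r t Hr Ht.
set (X := B * r ^ N).
assert (HrN : 1 <= r ^ N) by (apply pow_R1_Rle; lra).
assert (HX : 1 <= X) by (unfold X; nra).
assert (PS : 0 <= source_bound X).
{ unfold source_bound; assert (H := exp_pos X).
  apply Rmult_le_pos; [lra|]; apply Rplus_le_le_0_compat; [apply Rmult_le_pos|]; lra. }
assert (G := energy_gronwall fd n (circle r1 t) (circle 1 t) X (source_bound X) (r - r1)
  (Cmod_circle 1 t Rle_0_1) ltac:(lra) ltac:(lra) PS).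
assert (Hl : forall s, 0 <= s <= r - r1 ->
  Cmod (line (circle r1 t) (circle 1 t) s) = r1 + s).
{ intros s Hs; rewrite line_circle, Cmod_circle; lra. }
specialize (G (fun s i Hs Hi => Hd _ i ltac:(rewrite (Hl s Hs); lra) Hi)).
specialize (G (fun s Hs => Hle _ r ltac:(rewrite (Hl s Hs); lra) ltac:(rewrite (Hl s Hs); lra))).
rewrite line_circle in G.
replace (r1 + (r - r1)) with r in G by ring.
(* The first two terms bound the logarithm of initial energy plus squared source, by
   [E + exp (8 * X) <= exp E * exp (8 * X)]; the last is the Gronwall exponent. *)
set (Y := E + 8 * X + (2 + 2 * X ^ 2) * r).
assert (PX2 := pow2_ge_0 X).
assert (HY : Cmod (fd O (circle r t)) ^ 2 <= exp Y).
{ eapply Rle_trans; [exact G|].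
  unfold Y; rewrite exp_plus.
  apply Rmult_le_compat.
  - assert (H := energy_ge_0 fd n (circle r1 t)); assert (H' := pow2_ge_0 (source_bound X)); lra.
  - left; apply exp_pos.
  - rewrite exp_plus.
    assert (H1 := HE t Ht); assert (H2 := source_bound_sqr_le X HX).
    assert (H3 := exp_ineq1_le E).
    assert (H4 := exp_ineq1_le (8 * X)).
    nra.
  - apply exp_le, Rmult_le_compat_l; lra. }
assert (HYC : Y <= (E + 8 * B + (2 + 2 * B ^ 2)) * r ^ (2 * N + 1)).
{ assert (HP : r ^ (2 * N + 1) = r ^ N * r ^ N * r).
  { rewrite pow_add, pow_1; replace (2 * N)%nat with (N + N)%nat by lia.
    rewrite pow_add; ring. }
  unfold Y, X; rewrite HP.
  set (q := r ^ N) in *; clearbody q.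
  assert (I0 : q <= q * q) by nra.
  assert (I1 : 1 <= q * q * r) by nra.
  assert (I2 : q <= q * q * r) by (assert (0 <= q * q * (r - 1)) by (apply Rmult_le_pos; nra); lra).
  assert (I3 : r <= q * q * r) by (assert (0 <= (q * q - 1) * r) by (apply Rmult_le_pos; lra); lra).
  assert (J1 := Rmult_le_compat_l E _ _ PE I1).
  assert (J2 := Rmult_le_compat_l (8 * B) _ _ ltac:(lra) I2).
  replace ((E + 8 * B + (2 + 2 * B ^ 2)) * (q * q * r)) with
    (E * (q * q * r) + 8 * B * (q * q * r) + 2 * (q * q * r) + 2 * (B * q) ^ 2 * r) by ring.
  lra. }
apply Rle_trans with (exp Y); [|apply exp_le; exact HYC].
assert (PY : 0 <= Y) by (unfold Y; nra).
assert (H1 : 1 <= exp Y) by (assert (H := exp_ineq1_le Y); lra).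
assert (H0 := Cmod_ge_0 (fd O (circle r t))).
nra.
Qed.

(** * The Nevanlinna characteristic *)

Module LebesgueBound.
Import all_boot order ssralg ssrnum interval classical_sets functions ereal measure
  lebesgue_stieltjes_measure lebesgue_measure lebesgue_integral constructive_ereal.

Lemma Lint_le (g : R -> R) (a b S : R) :
  a < b -> (forall x, (a <= x <= b) -> (0 <= g x <= S)) ->
  (Lint g a b <= S * (b - a)).
Proof.
move=> ab gS.
have S0 : (0 <= S).
  by have [] := gS a (conj (Rle_refl a) (Rlt_le _ _ ab)); apply: Rle_trans.
rewrite /Lint.
set D := (D in lebesgue_integral_definition.integral _ D _).
have DE : D = [set` Interval (BLeft a) (BRight b)]%classic.
  apply/seteqP; split=> x /=; rewrite /D in_itv /=.
    by case=> /RleP -> /RleP ->.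
  by case/andP => /RleP ? /RleP.
have mD : measurable (D : set (measurableTypeR (R : realType))) by rewrite DE; exact: measurable_itv.
have Dg0 x : D x -> (0 <= (g x)%:E)%E.
  by move=> /gS [/RleP + _]; rewrite lee_fin.
have DS0 x : D x -> (0 <= cst S%:E x)%E.
  by move=> _; rewrite lee_fin; exact/RleP.
have muD : lebesgue_measure D = (b - a)%:E :> \bar R.
  by rewrite DE lebesgue_measure_itv /= lte_fin; move/RltP: ab => ->; rewrite -EFinB.
(* For nonnegative functions the integral is a supremum over simple functions lying below, hence
   monotone for an arbitrary [g]. *)
have le : (\int[lebesgue_measure]_(x in D) (g x)%:E <= \int[lebesgue_measure]_(x in D) (cst S%:E x))%E.
  rewrite !ge0_integralE //; apply: ge_ereal_sup => _ [h /= hg <-].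
  apply: ereal_sup_ubound; exists h => //= x.
  apply: (Order.POrderTheory.le_trans (hg x)); rewrite /patch.
  by case: ifPn => //; rewrite inE => /gS[_ /RleP]; rewrite lee_fin.
move: le; rewrite integral_cst //.
rewrite [X in (_ <= _ * X)%E](_ : _ = (b - a)%:E) // -EFinM => le.
apply/RleP.
(* The two bounds exclude infinite values, which [fine] would send to [0]. *)
have ge : (0 <= \int[lebesgue_measure]_(x in D) (g x)%:E)%E by exact: integral_ge0.
move: le ge; case: (lebesgue_integral_definition.integral _ _ _) => [r| |] //=.
Qed.
End LebesgueBound.

Lemma npoles_eq (f : C -> C) (P : C -> Prop) (t t' : R) :
  (forall p, P p -> (Cmod p <= t <-> Cmod p <= t')) -> npoles f P t = npoles f P t'.
Proof.
intros H; unfold npoles; f_equal; apply Lub_Rbar_eqset.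
assert (D : forall s s', (forall p, P p -> (Cmod p <= s <-> Cmod p <= s')) ->
  forall x, (exists n, count_rel f P s n /\ x = INR n) ->
    exists n, count_rel f P s' n /\ x = INR n).
{ clear; intros s s' H x [n [[l [H1 [H2 H3]]] Hx]].
  exists n; split; [|exact Hx].
  exists l; split; [exact H1|]; split; [|exact H3].
  intros p; rewrite <- H2; specialize (H p); tauto. }
intros x; split; apply D; [exact H|].
intros p Hp; symmetry; apply H; exact Hp.
Qed.

(* [RInt] of a non-integrable function is a junk value which does not depend on
   the function, so the bound needs no integrability of [npoles]. *)
Lemma RInt_junk (g : R -> R) (a b : R) :
  ~ ex_RInt g a b -> RInt g a b = iota (fun _ : R => False).
Proof.
intros H; unfold RInt; f_equal.
apply functional_extensionality; intros x; apply propositional_extensionality.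
split; [intros Hx; apply H; exists x; exact Hx | contradiction].
Qed.

Lemma is_RInt_div (v a b : R) :
  0 < a -> a <= b -> is_RInt (fun t => v / t) a b (v * (ln b - ln a)).
Proof.
intros Ha Hab.
replace (v * (ln b - ln a)) with (minus (v * ln b) (v * ln a))
  by (unfold minus, plus, opp; simpl; ring).
apply (is_RInt_derive (fun t => v * ln t)).
- intros x; rewrite Rmin_left, Rmax_right by lra; intros Hx.
  auto_derive; [lra | unfold Rdiv; ring].
- intros x; rewrite Rmin_left, Rmax_right by lra; intros Hx.
  apply (ex_derive_continuous (fun t => v / t)).
  auto_derive; lra.
Qed.

(** No pole lies beyond [r1], so there the integrand is [v / t] and contributes
    [v * (ln r - ln r1)]. *)
Lemma Ncount_log_bound (f : C -> C) (P : C -> Prop) (r1 : R) :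
  1 <= r1 -> (forall p, P p -> Cmod p <= r1) ->
  exists A B, forall r, r1 <= r -> Ncount f P r <= A + B * ln r.
Proof.
intros Hr1 HP.
set (h := fun t => (npoles f P t - npoles f P 0) / t).
set (v := npoles f P r1 - npoles f P 0).
assert (Hh : forall t, r1 <= t -> h t = v / t).
{ intros t Ht; unfold h, v; do 2 f_equal.
  apply npoles_eq; intros p Hp; specialize (HP p Hp); lra. }
set (J := iota (fun _ : R => False)).
(* The maximum with [J] covers a non-integrable [h]; [Rmax 0 v] keeps the logarithmic term
   nonnegative in that case. *)
exists (Rmax J (RInt h 0 r1 - v * ln r1)), (Rmax 0 v + npoles f P 0).
intros r Hr; unfold Ncount; fold h.
assert (Hln : 0 <= ln r) by (rewrite <- ln_1; apply ln_le; lra).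
assert (Hv1 := Rmax_l 0 v).
assert (Hv2 := Rmax_r 0 v).
assert (HJ1 := Rmax_l J (RInt h 0 r1 - v * ln r1)).
assert (HJ2 := Rmax_r J (RInt h 0 r1 - v * ln r1)).
assert (RInt h 0 r <= Rmax J (RInt h 0 r1 - v * ln r1) + Rmax 0 v * ln r).
{ destruct (classic (ex_RInt h 0 r)) as [Hex|Hex].
  - assert (Hex1 : ex_RInt h 0 r1) by (apply (ex_RInt_Chasles_1 h 0 r1 r); [lra | exact Hex]).
    assert (Htail : is_RInt h r1 r (v * (ln r - ln r1))).
    { apply (is_RInt_ext (fun t => v / t)).
      - intros x; rewrite Rmin_left, Rmax_right by lra; intros Hx; symmetry; apply Hh; lra.
      - apply is_RInt_div; lra. }
    assert (HC := RInt_Chasles h 0 r1 r Hex1 (ex_intro _ _ Htail)).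
    rewrite (is_RInt_unique _ _ _ _ Htail) in HC.
    rewrite <- HC; unfold plus; simpl.
    assert (v * ln r <= Rmax 0 v * ln r) by (apply Rmult_le_compat_r; lra).
    lra.
  - rewrite (RInt_junk _ _ _ Hex); fold J.
    assert (0 <= Rmax 0 v * ln r) by (apply Rmult_le_pos; lra).
    lra. }
lra.
Qed.

Lemma ln_nonpos (x : R) : x <= 0 -> ln x = 0.
Proof. intros H; unfold ln; destruct (Rlt_dec 0 x); [exfalso; lra | reflexivity]. Qed.

(** The order is an infimum over starting radii, so the supremum beyond this one [r0], at most [n],
    already bounds it. *)
Lemma order_finite_of_power_bound (f : C -> C) (P : C -> Prop) (r0 : R) (n : nat) :
  1 < r0 -> (forall r, r0 < r -> Tchar f P r <= r ^ n) -> order f P <> p_infty.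
Proof.
intros Hr0 HT Hinf; unfold order in Hinf.
set (y := Lub_Rbar (fun x => exists r, r0 < r /\ x = ln (Tchar f P r) / ln r)).
assert (Hy : Rbar_le y (INR n)).
{ apply Lub_Rbar_correct; intros x [r [Hr Hx]]; rewrite Hx; simpl.
  assert (Hln : 0 < ln r) by (rewrite <- ln_1; apply ln_increasing; lra).
  apply (Rmult_le_reg_r (ln r)); [exact Hln|].
  unfold Rdiv; rewrite Rmult_assoc, Rinv_l, Rmult_1_r by lra.
  destruct (Rle_or_lt (Tchar f P r) 0) as [H|H].
  - rewrite (ln_nonpos _ H); apply Rmult_le_pos; [apply pos_INR | lra].
  - rewrite <- ln_pow by lra; apply ln_le; auto. }
unfold Rbar_glb in Hinf.
destruct Rbar_ex_glb as [g [Hg Hgreatest]]; simpl in Hinf; subst g.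
assert (H : Rbar_le p_infty y) by (apply Hg; exists r0; split; [exact Hr0 | reflexivity]).
destruct y; simpl in *; contradiction.
Qed.

Lemma prox_le (f : C -> C) (r S : R) :
  0 <= S -> (forall t, 0 <= t <= 2 * PI -> Cmod (f (circle r t)) <= exp S) ->
  prox f r <= S.
Proof.
intros HS Hf; unfold prox.
assert (HPI := PI_RGT_0).
assert (HL : Lint (fun t => logplus (Cmod (f (r * cos t, r * sin t)))) 0 (2 * PI)
             <= S * (2 * PI - 0)).
{ apply LebesgueBound.Lint_le; [lra|].
  intros t Ht; unfold logplus; split; [apply Rmax_l|].
  apply Rmax_lub; [exact HS|].
  destruct (Rle_or_lt (Cmod (f (r * cos t, r * sin t))) 0) as [H|H].
  - rewrite (ln_nonpos _ H); exact HS.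
  - rewrite <- (ln_exp S); apply ln_le; [exact H | apply (Hf t Ht)]. }
apply (Rmult_le_compat_l (/ (2 * PI))) in HL; [|left; apply Rinv_0_lt_compat; lra].
replace (/ (2 * PI) * (S * (2 * PI - 0))) with S in HL by (field; lra).
exact HL.
Qed.

Lemma eventually_below_power (C0 A B : R) (N : nat) :
  0 <= C0 -> exists r0, 1 < r0 /\
    forall r, r0 < r -> C0 * r ^ N + (A + B * ln r) <= r ^ (N + 2).
Proof.
intros HC.
assert (PA := Rabs_pos A); assert (PB := Rabs_pos B).
(* Each term on the left is at most its coefficient times [r ^ N * r]; the remaining factor [r]
   exceeds the sum of the coefficients. *)
exists (C0 + Rabs A + Rabs B + 2); split; [lra|].
intros r Hr.
assert (HN : 1 <= r ^ N) by (apply pow_R1_Rle; lra).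
assert (Hl0 : 0 <= ln r) by (rewrite <- ln_1; apply ln_le; lra).
assert (Hl : ln r <= r).
{ rewrite <- (ln_exp r) at 2; apply ln_le; [lra|].
  assert (H := exp_ineq1_le r); lra. }
assert (HA := Rle_abs A); assert (HB := Rle_abs B).
assert (H1 : B * ln r <= Rabs B * r).
{ apply Rle_trans with (Rabs B * ln r);
    [apply Rmult_le_compat_r | apply Rmult_le_compat_l]; lra. }
replace (r ^ (N + 2)) with (r ^ N * r * r) by (rewrite pow_add; simpl; ring).
set (q := r ^ N) in *; clearbody q.
assert (Hqr : r <= q * r) by nra.
assert (Hq : q <= q * r) by nra.
assert (H2 : C0 * q <= C0 * (q * r)) by (apply Rmult_le_compat_l; lra).
assert (H3 : Rabs A * 1 <= Rabs A * (q * r)) by (apply Rmult_le_compat_l; lra).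
assert (H4 : Rabs B * r <= Rabs B * (q * r)) by (apply Rmult_le_compat_l; lra).
assert (H5 : (q * r) * (C0 + Rabs A + Rabs B) <= (q * r) * r)
  by (apply Rmult_le_compat_l; lra).
lra.
Qed.

(* Q = q1/q2, R = r1/r2 rational functions (not identically zero),
   alpha a polynomial, k >= 1, m >= 2. A meromorphic f (pole set P, with
   derivatives fd 1, ..., fd k) satisfying f^m + (R f^(k))^m = Q e^alpha
   (at all points where every term is defined) has finite order. *)
Theorem theorem2p2 (q1 q2 r1 r2 alpha : list C) (k m : nat)
  (f : C -> C) (P : C -> Prop) (fd : nat -> C -> C) :
  (exists z, peval q1 z <> RtoC 0) -> (exists z, peval q2 z <> RtoC 0) ->
  (exists z, peval r1 z <> RtoC 0) -> (exists z, peval r2 z <> RtoC 0) ->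
  (1 <= k)%nat -> (2 <= m)%nat ->
  meromorphic f P ->
  derivs_upto k P f fd ->
  (forall z, ~ P z -> peval q2 z <> RtoC 0 -> peval r2 z <> RtoC 0 ->
     Cplus (Cpow (f z) m)
           (Cpow (Cmult (Cdiv (peval r1 z) (peval r2 z)) (fd k z)) m)
     = Cmult (Cdiv (peval q1 z) (peval q2 z)) (Cexp (peval alpha z))) ->
  order f P <> p_infty.
Proof.
intros _ Hq2 Hr1 Hr2 Hk Hm [Hdiscrete [_ Hpoles]] [Hfd0 Hfd] Heq.
destruct (equation_differential_inequality q1 q2 r1 r2 alpha m f (fd k) (fun z => ~ P z)
  Hq2 Hr1 Hr2 ltac:(lia) Heq) as [B [N [r0 [HB [Hr0 Hode]]]]].
destruct k as [|n]; [lia|].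
assert (Hholo : forall p, r0 < Cmod p -> ~ P p).
{ intros p Hp HPp.
  destruct (Hpoles p HPp) as [j Hj].
  destruct (Hdiscrete p) as [d [Hd Hisolated]].
  set (rho := Cmod p + 1).
  assert (PX : 0 <= B * rho ^ N)
    by (apply Rmult_le_pos; [|apply pow_le]; unfold rho; lra).
  (* In the punctured disc, [d] excludes other poles, [1] keeps [|w| <= rho], and [Cmod p - r0]
     keeps [|w| >= r0]. *)
  apply (pole_excludes_differential_inequality f fd n j p
    (Rmin (Rmin d 1) (Cmod p - r0)) (B * rho ^ N) (source_bound (B * rho ^ N)) Hj Hfd0).
  - repeat apply Rmin_glb_lt; lra.
  - exact PX.
  - unfold source_bound; assert (H := exp_pos (B * rho ^ N)).
    apply Rmult_le_pos; [exact PX|].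
    apply Rplus_le_le_0_compat; [apply Rmult_le_pos|]; lra.
  - intros w [Hw0 Hw].
    assert (Hw1 := Rlt_le_trans _ _ _ Hw (Rmin_l _ _)).
    assert (Hw2 := Rlt_le_trans _ _ _ Hw (Rmin_r _ _)).
    assert (Hw3 := Rlt_le_trans _ _ _ Hw1 (Rmin_l _ _)).
    assert (Hw4 := Rlt_le_trans _ _ _ Hw1 (Rmin_r _ _)).
    assert (HPw : ~ P w).
    { intros HPw; assert (Hne : w <> p).
      { intros E; rewrite E in Hw0.
        replace (Cminus p p) with (RtoC 0) in Hw0 by ring.
        rewrite Cmod_0 in Hw0; lra. }
      specialize (Hisolated w HPw Hne); lra. }
    split; [intros i Hi; apply Hfd; [lia | exact HPw]|].
    assert (T1 := Cmod_triangle p (Cminus w p)).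
    assert (T2 := Cmod_triangle w (Copp (Cminus w p))).
    rewrite Cmod_opp in T2.
    replace (Cplus p (Cminus w p)) with w in T1 by ring.
    replace (Cplus w (Copp (Cminus w p))) with p in T2 by ring.
    apply Hode; [exact HPw | lra | unfold rho; lra]. }
(* The rays start at [r0 + 1] because poles are excluded only for [|z|] strictly above [r0]. *)
destruct (exp_growth_of_differential_inequality fd n N B (r0 + 1)) as [C0 [HC0 Hgrowth]].
- exact HB.
- lra.
- intros z i Hz Hi; apply Hfd; [lia | apply Hholo; lra].
- intros z rho Hz Hrho; rewrite Hfd0.
  apply Hode; [apply Hholo; lra | lra | exact Hrho].
- destruct (Ncount_log_bound f P (r0 + 1)) as [A1 [B1 HN]]; [lra | |].
  { intros p HPp; destruct (Rle_or_lt (Cmod p) (r0 + 1)) as [H|H]; [exact H|].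
    exfalso; apply (Hholo p); [lra | exact HPp]. }
  destruct (eventually_below_power C0 A1 B1 (2 * N + 1) HC0) as [s [Hs Hpow]].
  apply (order_finite_of_power_bound f P (Rmax s (r0 + 1)) (2 * N + 1 + 2)).
  + apply Rlt_le_trans with s; [exact Hs | apply Rmax_l].
  + intros r Hr.
    assert (Hr1' := Rle_lt_trans _ _ _ (Rmax_l _ _) Hr).
    assert (Hr2' := Rle_lt_trans _ _ _ (Rmax_r _ _) Hr).
    unfold Tchar.
    eapply Rle_trans; [|apply Hpow; exact Hr1'].
    apply Rplus_le_compat; [|apply HN; lra].
    apply prox_le.
    * apply Rmult_le_pos; [exact HC0 | apply pow_le; lra].
    * intros t Ht; rewrite <- Hfd0; apply Hgrowth; [lra | exact Ht].
Qed.
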